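(* Let $h \geq 2$, let $k_0 = \left\lfloor \frac{1}{2^{1/h}-1} \right\rfloor + 1$, and let $k_1 \geq k_0$ be an integer. Let $r_1 < r_2 < \cdots < r_h$ be pairwise relatively prime positive integers, and let $P$ be a positive integer such that $P \geq r_h - r_1$ and such that, whenever $1 \leq i < j \leq h$ and a prime $p$ divides $r_j - r_i$, $p$ divides $P$. For integers $k \geq 0$ define $s_{i,k} = kP + r_i$ ($i = 1,\ldots,h$), $S_k = \prod_{i=1}^h s_{i,k}$, and $a_{i,k} = S_k/s_{i,k} = \prod_{j\neq i} s_{j,k}$. For each positive integer $t$ let $\ell_t$ be the unique integer (with $\ell_t \ge -k_1$) such that $S_{k_1+\ell_t} \leq S_{k_1}^t < S_{k_1+\ell_t+1}$. For $t \geq 1$ let \[ V(t) = \left\{ a_{i,k_1+\ell_t}\, v : i \in \{1,\ldots,h\},\ v \in \mathbf{Z},\ 1 \leq v \leq \frac{(h-1)S_{k_1+\ell_{t+1}}}{a_{i,k_1+\ell_t}} \right\}. \] Then the set \[ \mathcal{A} = \{0,1,2,\ldots,(h-1)S_{k_1}\} \cup \bigcup_{t=1}^{\infty} V(t) \] is a thin basis of order $h$.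
   Context: $\lfloor \cdot \rfloor$ denotes the integer part. For a set $\mathcal{A}$ of nonnegative integers, $h\mathcal{A} = \{a_1 + \cdots + a_h : a_1,\ldots,a_h \in \mathcal{A}\}$ (not necessarily distinct summands). $\mathcal{A}$ is a basis of order $h$ if $h\mathcal{A}$ equals the set of all nonnegative integers. Its counting function is $A(x) = \#\{a \in \mathcal{A} : 1 \leq a \leq x\}$. A basis $\mathcal{A}$ of order $h$ is thin if $\limsup_{x\to\infty} A(x)/x^{1/h} < \infty$. *)

(* Defs.v *)
From mathcomp Require Import all_boot all_order all_algebra finmap.
From mathcomp Require Import all_classical all_reals all_analysis.

Set Implicit Arguments.
Unset Strict Implicit.
Unset Printing Implicit Defensive.

Import Order.TTheory GRing.Theory Num.Theory.
Import numFieldNormedType.Exports.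

Local Open Scope classical_set_scope.
Local Open Scope ring_scope.

Definition hfold (h : nat) (A : set nat) : set nat :=
  [set n | exists2 a : 'I_h -> nat,
             (forall i, A (a i)) & n = (\sum_(i < h) a i)%N].

Definition is_basis (h : nat) (A : set nat) : Prop := hfold h A = setT.

(* [fset_set] is only meaningful on finite sets, which this one always is. *)
Definition counting_fun (R : realType) (A : set nat) (x : R) : nat :=
  #|` fset_set [set a : nat | A a /\ 1 <= (a%:R : R) <= x] |.

(* The limsup is over real x tending to +oo and takes values in [-oo, +oo]. *)
Definition is_thin_basis (R : realType) (h : nat) (A : set nat) : Prop :=
  is_basis h A /\
  (limf_esup
     (fun x : R => ((counting_fun A x)%:R / x `^ (h%:R^-1))%:E)
     (pinfty_nbhs R) < +oo)%E.

Definition k0 (R : realType) (h : nat) : int :=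
  Num.floor (1 / ((2 : R) `^ (h%:R^-1) - 1)) + 1.

(* A sequence r_1, ..., r_h is a function r : nat -> nat of which only the
   values at 1, ..., h are ever used. *)
Definition sprog (P : nat) (r : nat -> nat) (i k : nat) : nat :=
  (k * P + r i)%N.

Definition Sprod (h P : nat) (r : nat -> nat) (k : nat) : nat :=
  (\prod_(1 <= i < h.+1) sprog P r i k)%N.

Definition aprod (h P : nat) (r : nat -> nat) (i k : nat) : nat :=
  (\prod_(1 <= j < h.+1 | j != i) sprog P r j k)%N.

(* The index k1 + l, used only for integers l >= - k1, where the absolute
   value changes nothing. *)
Definition shift (k1 : nat) (l : int) : nat := `|(k1%:Z + l)%R|%N.

(* [xget] is a description operator: the value is the integer satisfying the
   condition, the default 0 being irrelevant since exactly one exists for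
   t >= 1 when P and r_1, ..., r_h are positive and h >= 1. *)
Definition ell (h P : nat) (r : nat -> nat) (k1 t : nat) : int :=
  xget 0 [set l : int | - k1%:Z <= l /\
    (Sprod h P r (shift k1 l) <= Sprod h P r k1 ^ t
       < Sprod h P r (shift k1 (l + 1)))%N].

Definition Vset (h P : nat) (r : nat -> nat) (k1 t : nat) : set nat :=
  let K u := shift k1 (ell h P r k1 u) in
  [set n | exists i v : nat,
    [/\ (1 <= i <= h)%N,
        (1 <= v)%N,
        (v%:R : rat) <=
          ((h - 1) * Sprod h P r (K t.+1))%:R / (aprod h P r i (K t))%:R
      & n = (aprod h P r i (K t) * v)%N]].

Definition thin_set (h P : nat) (r : nat -> nat) (k1 : nat) : set nat :=
  [set n | (n <= (h - 1) * Sprod h P r k1)%N]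
  `|` \bigcup_(t in [set t | (1 <= t)%N]) Vset h P r k1 t.

(* Main.v *)
(* With s_i = s_{i,k} pairwise coprime (a common prime of two of them divides P,
   hence r_i and r_j), every n >= (h-1) S_k is sum_i a_{i,k} v_i with v_i >= 0:
   fix v_i modulo s_i for i < h, the remainder being a nonnegative multiple of
   a_{h,k}. Since S_{k+1} <= 2 S_k beyond k_0, the S_{k_1+l_t} grow like
   M^t with M = S_{k_1}, and the intervals [(h-1)S_{k_1+l_t}, (h-1)S_{k_1+l_{t+1}}]
   exhaust the large integers. For thinness put q = M^(1/h) and y = x^(1/h): all
   s_i are of size q^t at level t, so V(t) has O(q^t) elements, and at most
   O(x / q^(t(h-1))) = O(y^2 / q^t) of them are <= x once q^t > y. The sum over t
   of min(q^t, y^2/q^t) is O(y). *)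
Require Import Defs.
From mathcomp Require Import all_boot all_order all_algebra finmap.
From mathcomp Require Import all_classical all_reals all_analysis.
From mathcomp Require Import zify ring lra.

Set Implicit Arguments.
Unset Strict Implicit.
Unset Printing Implicit Defensive.

Import Order.TTheory GRing.Theory Num.Theory.
Import numFieldNormedType.Exports.

(** * Representation by cofactors of pairwise coprime moduli *)

Lemma mul_modn_surj (a s n : nat) : (0 < s)%N -> coprime a s ->
  exists2 v, (v < s)%N & a * v = n %[mod s].
Proof.
(* A Chinese remainder that vanishes modulo [a] is a multiple of [a]. *)
move=> s_gt0 cas; have [u uE] : exists u, chinese a s 0 n = (a * u)%N.
  have: (a %| chinese a s 0 n)%N by rewrite /dvdn chinese_modl // mod0n.
  by move=> /dvdnP[u ->]; exists u; rewrite mulnC.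
exists (u %% s)%N; first by rewrite ltn_mod.
by rewrite modnMmr -uE chinese_modr.
Qed.

(** Induction on [h]: the last coefficient is a residue [v < s h] making [n - S * v] divisible by
    [s h], with [S] the product of the other moduli. The quotient is decomposed over those moduli,
    and multiplying back by [s h] restores the cofactors. *)
Lemma cofactor_sum (s : nat -> nat) (h n : nat) : (1 <= h)%N ->
  (forall i, (1 <= i <= h)%N -> (0 < s i)%N) ->
  (forall i j, (1 <= i)%N -> (i < j)%N -> (j <= h)%N -> coprime (s i) (s j)) ->
  ((h - 1) * \prod_(1 <= i < h.+1) s i <= n)%N ->
  exists v : nat -> nat,
    n = (\sum_(1 <= i < h.+1) (\prod_(1 <= j < h.+1 | j != i) s j) * v i)%N.
Proof.
elim: h n => // -[_ n _ _ _ _|h IH n _ s_gt0 cs].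
  by exists (fun=> n); rewrite big_nat1 big_mkcond big_nat1 mul1n.
rewrite big_nat_recr //= subn1 /=.
set S := (\prod_(1 <= i < h.+2) s i)%N => len.
have cS : coprime S (s h.+2).
  rewrite /S big_nat; elim/big_ind: _ => [|x y cx cy|i hi].
  - exact: coprime1n.
  - by rewrite coprimeMl cx.
  - by apply: cs; lia.
have sh_gt0 : (0 < s h.+2)%N by apply: s_gt0; lia.
have [v vs vE] := mul_modn_surj n sh_gt0 cS.
have Sv_le : (S * v <= n)%N by nia.
have /dvdnP[m mE] : (s h.+2 %| n - S * v)%N by rewrite -eqn_mod_dvd // vE.
(* Since [v < s h.+2], subtracting [S * v] costs less than one of the [h.+1] copies of [S * s h.+2]
   contained in [n]. *)
have lem : ((h.+1 - 1) * S <= m)%N.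
  rewrite -(leq_pmul2r sh_gt0) -mE; nia.
have [||||w wE] := IH m => //.
- by move=> i hi; apply: s_gt0; lia.
- by move=> i j *; apply: cs; lia.
exists (fun i => if i == h.+2 then v else w i).
rewrite big_nat_recr //= eqxx.
have -> : (\prod_(1 <= j < h.+3 | j != h.+2) s j = S)%N.
  rewrite big_mkcond big_nat_recr //= eqxx muln1 /S [LHS]big_nat [RHS]big_nat.
  by apply: eq_bigr => i hi; rewrite ifT //; lia.
rewrite -[LHS](subnK Sv_le) mE wE big_distrl /=; congr addn.
rewrite [LHS]big_nat [RHS]big_nat; apply: eq_bigr => i hi.
rewrite ifF; last by lia.
rewrite [in RHS]big_mkcond big_nat_recr //= ifT; last by lia.
by rewrite -[in RHS]big_mkcond mulnAC.
Qed.

(** * Sums that rise and then fall geometrically *)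

Local Open Scope ring_scope.

(* The minimum of q ^+ t and y ^+ 2 / q ^+ t. *)
Definition tent (R : realFieldType) (q y : R) (t : nat) : R :=
  if q ^+ t <= y then q ^+ t else y ^+ 2 / q ^+ t.

Lemma tent_ge0 (R : realFieldType) (q y : R) (t : nat) : 0 <= q -> 0 <= tent q y t.
Proof.
by move=> q0; rewrite /tent; case: ifP => _; rewrite ?divr_ge0 ?sqr_ge0 ?exprn_ge0.
Qed.

(** With [E = 1 / (1 - q^-1)], the rising and the falling terms each sum to at most [E * y]. Past
    the peak, the inductive bound subtracts the tail [E * y ^+ 2 / q ^+ N] still to come. *)
Lemma sum_tent_le (R : realFieldType) (q y : R) (N : nat) : 1 < q -> 0 < y ->
  \sum_(t < N) tent q y t <= q / (q - 1) * 2 * y.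
Proof.
move=> q1 y0; set E := q / (q - 1).
have q0 : 0 < q by lra.
have E0 : 0 < E by apply: divr_gt0; lra.
have EE : E * (1 - q^-1) = 1 by rewrite /E; field; apply/andP; split; lra.
have Eq : E * (q - 1) = q by rewrite /E; field; lra.
(* The bound depends on N only through q ^+ N, so it can be proved by induction. *)
have G : \sum_(t < N) tent q y t <=
  if q ^+ N <= y then q ^+ N / (q - 1) else E * 2 * y - E * y ^+ 2 / q ^+ N.
  elim: N => [|N IH].
    rewrite big_ord0 expr0; case: ifPn => y1.
      by apply: divr_ge0; lra.
    have -> : E * 2 * y - E * y ^+ 2 / 1 = E * (y * (2 - y)) by field.
    by apply: mulr_ge0; [exact: ltW|apply: mulr_ge0; lra].
  rewrite big_ord_recr /= [tent _ _ N]/tent; move: IH; set s := \sum_(t < N) _.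
  rewrite (exprS q N); set z := q ^+ N; have z0 : 0 < z by exact: exprn_gt0.
  case: ifPn => zy.
    have -> : z / (q - 1) = E * z - z.
      by rewrite /E; field; lra.
    move=> IH; case: ifPn => qzy.
      have -> : q * z / (q - 1) = E * z by rewrite /E; field; lra.
      lra.
    (* The peak is crossed here: [y < q * z] keeps the remaining tail below [E * y], and
       [E * z <= E * y]. *)
    have qz0 : 0 < q * z by exact: mulr_gt0.
    have : y ^+ 2 / (q * z) <= y by rewrite ler_pdivrMr // expr2; nra.
    rewrite -mulrA; nra.
  have /negPf -> : ~~ (q * z <= y) by nra.
  move=> IH; rewrite invfM.
  have : E * y ^+ 2 * (q^-1 * z^-1) = E * y ^+ 2 / z - y ^+ 2 / z.
    rewrite -[X in _ - X]mul1r -EE; ring.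
  lra.
apply: (le_trans G); case: ifPn => zy.
  have -> : q ^+ N / (q - 1) = E * q ^+ N / q.
    by rewrite /E; field; apply/andP; split; lra.
  rewrite ler_pdivrMr //; nra.
rewrite gerBl; apply: divr_ge0; last by apply: exprn_ge0; lra.
by apply: mulr_ge0; [lra | exact: sqr_ge0].
Qed.

(** * Auxiliary estimates for counting and growth *)

Lemma leq_prod_nat (m n : nat) (P : pred nat) (f g : nat -> nat) :
  (forall i, (m <= i < n)%N -> P i -> (f i <= g i)%N) ->
  (\prod_(m <= i < n | P i) f i <= \prod_(m <= i < n | P i) g i)%N.
Proof.
move=> fg; rewrite big_nat_cond [leqRHS]big_nat_cond.
elim/big_ind2: _ => [//|a b c d|i /andP[]]; [exact: leq_mul | exact: fg].
Qed.

Lemma size_flatten_map (S T : Type) (f : S -> seq T) (s : seq S) :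
  size (flatten [seq f x | x <- s]) = (\sum_(x <- s) size (f x))%N.
Proof. by rewrite size_flatten sumnE !big_map. Qed.

(** The list may repeat entries, so overlapping progressions can simply be concatenated. The
    inclusion also gives the finiteness that [fset_set] requires. *)
Lemma counting_fun_le_size (R : realType) (A : set nat) (x : R) (s : seq nat) :
  (forall a, A a -> (1 <= a)%N -> a%:R <= x -> a \in s) ->
  (counting_fun A x <= size s)%N.
Proof.
move=> As; rewrite /counting_fun.
apply: (@leq_trans #|` [fset a in s]%fset|); last first.
  by rewrite card_fseq size_undup.
apply: fsubset_leq_card; rewrite -(set_fsetK [fset a in s]%fset).
have sub : ([set a : nat | A a /\ 1 <= (a%:R : R) <= x]
    `<=` [set` [fset a in s]%fset])%classic.
  move=> a /= [Aa /andP[a1 ax]]; rewrite inE; apply: As => //.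
  by rewrite ler1n in a1.
by rewrite -fset_set_sub //; exact: sub_finite_set sub (finite_fset _).
Qed.

(** With [w = 2^(1/h)], the inequality [k > 1 / (w - 1)] amounts to [k + 1 < w * k]; raise this to
    the power [h]. *)
Lemma expnS_le_double (R : realType) (h k : nat) : (0 < h)%N ->
  k0 R h <= k%:Z -> (0 < k)%N && (k.+1 ^ h <= 2 * k ^ h)%N.
Proof.
move=> h0; rewrite /k0; set w := (2 : R) `^ _ => hk.
have wh : w ^+ h = 2.
  rewrite /w -powR_mulrn ?powR_ge0 // -powRrM mulVf ?powRr1 //.
  by rewrite pnatr_eq0 -lt0n.
have w1 : 1 < w.
  have -> : 1 = (1 : R) `^ (h%:R^-1) by rewrite powR1.
  by apply: gt0_ltr_powR; rewrite ?nnegrE ?invr_gt0 ?ltr0n //; lra.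
have kw : 1 / (w - 1) < k%:R.
  apply: lt_le_trans (floorD1_gt _) _.
  by rewrite pmulrn ler_int.
have k0' : (0 : R) < k%:R by apply: le_lt_trans kw; apply: divr_ge0; lra.
rewrite -(ltr0n R) k0' /= -(ler_nat R) natrM !natrX -wh -exprMn.
apply: lerXn2r; rewrite ?nnegrE ?ler0n ?mulr_ge0 ?ler0n //; first by lra.
move: kw; rewrite ltr_pdivrMr; last by lra.
rewrite -natr1; lra.
Qed.

(* Meant for s = s_{1,k}, m = S_{k_1}, a = a_{i,k} with k = k_1 + l_t, and b a
   number of multiples of a. *)
Lemma natr_le_tent (R : realFieldType) (h t b s a c m : nat) (q x y : R) :
  (2 <= h)%N -> 0 < q -> 0 < y -> q ^+ h = m%:R -> y ^+ h = x ->
  (s ^ h <= m ^ t)%N -> (m ^ t <= (4 * s) ^ h)%N -> (s ^ h <= s * a)%N ->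
  (b <= c * s)%N -> (b * a)%:R <= x ->
  b%:R <= (c + 4 ^ h)%:R * tent q y t.
Proof.
move=> h_ge2 q0 y0 qm yx sm ms sa bs bax; rewrite /tent; set z := q ^+ t.
have h_gt0 : (0 < h)%N by lia.
have z0 : 0 < z by exact: exprn_gt0.
have zh : z ^+ h = (m ^ t)%:R by rewrite -exprM mulnC exprM qm natrX.
have sz : s%:R <= z.
  by rewrite -(@ler_pXn2r _ h) ?nnegrE ?ler0n ?(ltW z0) // zh -natrX ler_nat.
have zs : z <= (4 * s)%:R.
  by rewrite -(@ler_pXn2r _ h) ?nnegrE ?ler0n ?(ltW z0) // zh -natrX ler_nat.
rewrite natrD; have c0 : (0 : R) <= c%:R by exact: ler0n.
have f0 : (0 : R) <= (4 ^ h)%:R by exact: ler0n.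
case: ifPn => [_|zy].
  have : (b%:R : R) <= c%:R * s%:R by rewrite -natrM ler_nat.
  by nra.
have {}zy : y <= z by rewrite -/z in zy; lra.
suff bz : b%:R <= (4 ^ h)%:R * (y ^+ 2 / z).
  have : 0 <= y ^+ 2 / z by apply: divr_ge0; [exact: sqr_ge0 | exact: ltW].
  nra.
(* After multiplication by [z ^+ h.-1], the chain is [b z^h <= 4^h s (b a) <= 4^h s x], closed by
   [s <= z] and [x = y^h <= y^2 z^(h-2)]. *)
rewrite mulrA ler_pdivlMr // -(@ler_pM2r _ (z ^+ h.-1)) ?exprn_gt0 //.
rewrite -[leLHS]mulrA -exprS prednK //.
have yh : x <= y ^+ 2 * z ^+ (h - 2).
  rewrite -yx -[in leLHS](subnKC h_ge2) exprD ler_pM2l ?exprn_gt0 //.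
  by apply: lerXn2r => //; rewrite nnegrE ltW //; lra.
have -> : z ^+ h.-1 = z ^+ (h - 2) * z.
  by rewrite -exprSr; congr (_ ^+ _); lia.
apply: (@le_trans _ _ (b%:R * (4 ^ h * (s * a))%:R)).
  apply: ler_wpM2l; rewrite ?ler0n // zh ler_nat (leq_trans ms) // expnMn.
  by rewrite leq_mul2l sa orbT.
rewrite -natrM (_ : (_ * _)%N = (4 ^ h * s * (b * a))%N); last by nia.
rewrite !natrM -natrM -natrM.
apply: (@le_trans _ _ ((4 ^ h * s)%:R * (y ^+ 2 * z ^+ (h - 2)))).
  by apply: ler_wpM2l; rewrite ?ler0n // (le_trans bax).
have -> : (4 ^ h)%:R * y ^+ 2 * (z ^+ (h - 2) * z) =
  (4 ^ h)%:R * z * (y ^+ 2 * z ^+ (h - 2)) by ring.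
apply: ler_wpM2r; first by rewrite mulr_ge0 // exprn_ge0 // ltW.
by rewrite natrM ler_wpM2l.
Qed.

(** * Growth of the products [S k] *)

Section Progressions.
Variables (h P : nat) (r : nat -> nat).
Hypotheses (h_ge2 : (2 <= h)%N) (P_gt0 : (0 < P)%N).
Hypothesis r_gt0 : forall i, (1 <= i <= h)%N -> (0 < r i)%N.
Hypothesis r_incr :
  forall i j, (1 <= i)%N -> (i < j)%N -> (j <= h)%N -> (r i < r j)%N.

Notation s := (sprog P r).
Notation S := (Sprod h P r).
Notation a := (aprod h P r).

Lemma sprog_gt0 i k : (1 <= i <= h)%N -> (0 < s i k)%N.
Proof. by move=> /r_gt0; rewrite /sprog; lia. Qed.

Lemma Sprod_gt0 k : (0 < S k)%N.
Proof.
rewrite /Sprod big_nat; apply: prodn_cond_gt0 => i hi.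
by apply: sprog_gt0; lia.
Qed.

Lemma Sprod_mulD1 i k : (1 <= i <= h)%N -> S k = (s i k * a i k)%N.
Proof.
move=> hi; rewrite /Sprod (bigD1_seq i) ?iota_uniq //=.
by rewrite mem_index_iota; lia.
Qed.

Lemma aprod_gt0 i k : (1 <= i <= h)%N -> (0 < a i k)%N.
Proof. by move=> /(Sprod_mulD1 k) SE; move: (Sprod_gt0 k); rewrite SE; lia. Qed.

Lemma ltn_Sprod k : (S k < S k.+1)%N.
Proof.
have h1 : (1 <= 1 <= h)%N by lia.
rewrite !(Sprod_mulD1 _ h1).
have aa : (a 1 k <= a 1 k.+1)%N.
  by apply: leq_prod_nat => i _ _; rewrite /sprog; nia.
have := aprod_gt0 k h1.
have : (s 1 k < s 1 k.+1)%N by rewrite /sprog; nia.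
nia.
Qed.

Lemma Sprod_mono : {mono S : k l / (k <= l)%N}.
Proof.
apply: leq_mono; apply: homo_ltn => [y x z|i]; [exact: ltn_trans|exact: ltn_Sprod].
Qed.

Lemma Sprod_mono_lt : {mono S : k l / (k < l)%N}.
Proof. by move=> k l; rewrite !ltnNge Sprod_mono. Qed.

Lemma ltn_id_Sprod k : (k < S k)%N.
Proof.
by elim: k => [|k IH]; [exact: Sprod_gt0 | exact: leq_ltn_trans (ltn_Sprod k)].
Qed.

(** Factor by factor, [k * s i k.+1 <= k.+1 * s i k]. *)
Lemma Sprod_double k : (0 < k)%N -> (k.+1 ^ h <= 2 * k ^ h)%N ->
  (S k.+1 <= 2 * S k)%N.
Proof.
move=> k_gt0 hk; rewrite -(@leq_pmul2r (k ^ h)%N) ?expn_gt0 ?k_gt0 //.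
apply: (@leq_trans (S k * k.+1 ^ h)%N); last by nia.
have expnE n : (n ^ h = \prod_(1 <= i < h.+1) n)%N by rewrite prod_nat_const_nat subn1.
rewrite !expnE /Sprod -!big_split.
apply: leq_prod_nat => i _ _ /=; rewrite /sprog; nia.
Qed.

(** * The levels, where [S] follows the powers of [M] *)

Section Levels.
Variable k1 : nat.
Hypothesis k1_gt0 : (0 < k1)%N.
Hypothesis hk1 : forall k, (k1 <= k)%N -> (k.+1 ^ h <= 2 * k ^ h)%N.

Notation M := (S k1).

(* [shift] alone would refer to the translation of MathComp-Analysis. *)
Definition level t := Defs.shift k1 (ell h P r k1 t).
Notation K := level.

(** It suffices that some integer meets the condition under [xget]: take the largest [m] with
    [S m <= M ^ t], which exists because [k < S k], and shift it by [k1]. *)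
Lemma level_spec t : (0 < t)%N -> (S (K t) <= M ^ t < S (K t).+1)%N.
Proof.
move=> t_gt0; rewrite /level /ell.
set Q := (X in xget _ X).
have [] : Q (xget 0 Q); last first.
  set l := xget 0 Q => lk; have -> // : Defs.shift k1 (l + 1) = (Defs.shift k1 l).+1.
  by rewrite /Defs.shift; lia.
apply: xgetPex.
have ex0 : exists k, (S k <= M ^ t)%N.
  by exists k1; rewrite -[leqLHS]expn1 leq_exp2l // (leq_ltn_trans k1_gt0) ?ltn_id_Sprod.
have bd k : (S k <= M ^ t)%N -> (k <= M ^ t)%N.
  by move=> /(leq_trans (ltnW (ltn_id_Sprod k))).
case: (ex_maxnP ex0 bd) => m Sm maxm.
exists (m%:Z - k1%:Z); split; first by lia.
have -> : Defs.shift k1 (m%:Z - k1%:Z) = m by rewrite /Defs.shift; lia.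
have -> : Defs.shift k1 (m%:Z - k1%:Z + 1) = m.+1 by rewrite /Defs.shift; lia.
by rewrite Sm /= ltnNge; apply/negP => /maxm; rewrite ltnn.
Qed.

Lemma Sbase_ge2 : (2 <= M)%N.
Proof. by apply: leq_ltn_trans k1_gt0 _; exact: ltn_id_Sprod. Qed.

Lemma level1 : K 1 = k1.
Proof.
have /andP[] := level_spec (ltn0Sn 0); rewrite expn1.
by rewrite Sprod_mono Sprod_mono_lt; lia.
Qed.

Lemma level_ge t : (0 < t)%N -> (k1 <= K t)%N.
Proof.
move=> t_gt0; have /andP[_] := level_spec t_gt0.
have : (M <= M ^ t)%N by rewrite -[leqLHS]expn1 leq_exp2l // Sbase_ge2.
by move=> /leq_ltn_trans/[apply]; rewrite Sprod_mono_lt.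
Qed.

Lemma expn_lt_double_level t : (0 < t)%N -> (M ^ t < 2 * S (K t))%N.
Proof.
move=> t_gt0; have kt := level_ge t_gt0.
have /andP[_ /leq_trans] := level_spec t_gt0; apply.
by apply: Sprod_double => //; [lia | exact: hk1].
Qed.

(** Consecutive levels differ by a bounded factor, which keeps each progression in [V(t)] of length
    [O(s 1 (K t))]. *)
Lemma Sprod_levelS t : (0 < t)%N -> (S (K t.+1) <= 2 * M * S (K t))%N.
Proof.
move=> t_gt0; have /andP[+ _] := level_spec (ltn0Sn t).
move=> /leq_trans; apply; rewrite expnS.
by have := expn_lt_double_level t_gt0; nia.
Qed.

Lemma VsetP t n : Vset h P r k1 t n <->
  exists i v, [/\ (1 <= i <= h)%N, (1 <= v)%N,
    (a i (K t) * v <= (h - 1) * S (K t.+1))%N & n = (a i (K t) * v)%N].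
Proof.
by split=> -[i [v [hi hv le_v ->]]]; exists i, v; split=> //; move: le_v;
  rewrite ler_pdivlMr ?ltr0n ?aprod_gt0 // -natrM ler_nat mulnC.
Qed.

(** * The basis property *)

Hypothesis s_coprime : forall i j k,
  (1 <= i)%N -> (i < j)%N -> (j <= h)%N -> coprime (s i k) (s j k).

Lemma thin_set_basis : is_basis h (thin_set h P r k1).
Proof.
apply/seteqP; split=> // n _.
have [n_le|n_gt] := leqP n ((h - 1) * M).
  exists (fun i : 'I_h => if i == 0%N :> nat then n else 0%N).
    by move=> i; left => /=; case: ifP.
  by case: h h_ge2 => // h' _; rewrite big_ord_recl /= big1 ?addn0.
have exT : exists T, (0 < T)%N && (n <= (h - 1) * S (K T))%N.
  (* For [T = 2n + 1], [T < M ^ T < 2 * S (K T)] gives [n < S (K T)]. *)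
  exists (2 * n).+1 => //=.
  have := expn_lt_double_level (ltn0Sn (2 * n)).
  have : ((2 * n).+1 < M ^ (2 * n).+1)%N by apply: ltn_expl Sbase_ge2.
  nia.
case: (ex_minnP exT) => -[//|t] /= n_le minT.
(* The least [T] is not 1, as [K 1 = k1] would put [n] in the initial segment. *)
have t_gt0 : (0 < t)%N.
  by case: t n_le {minT} => //; rewrite level1; lia.
have n_ge : ((h - 1) * S (K t) <= n)%N.
  rewrite leqNgt; apply/negP => n_lt; have := minT t.
  by rewrite t_gt0 ltnW // => /(_ isT); rewrite ltnn.
have [||||v nE] := @cofactor_sum (s ^~ (K t)) h n => //.
- by lia.
- by move=> i; exact: sprog_gt0.
- by move=> i j; exact: s_coprime.
rewrite big_add1 /= big_mkord in nE.
exists (fun i : 'I_h => (a i.+1 (K t) * v i.+1)%N) => [i|]; last by rewrite {1}nE.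
(* [Vset] demands [v >= 1]; a zero summand comes from the initial segment instead. *)
case: (posnP (v i.+1)) => [->|v_gt0]; first by left; rewrite /= muln0.
right; exists t => //; apply/VsetP; exists i.+1, (v i.+1).
split=> //; first exact: ltn_ord.
apply: leq_trans n_le; rewrite [leqRHS]nE (bigD1 i) //=; exact: leq_addr.
Qed.

(** * Thinness *)

Hypothesis r_bound : (r h <= P + r 1)%N.

Lemma sprog_le i k : (1 <= i <= h)%N -> (s 1 k <= s i k)%N.
Proof.
move=> hi; rewrite /sprog leq_add2l.
have [->//|i1] := eqVneq i 1%N; apply: ltnW; apply: r_incr; lia.
Qed.

Lemma sprog_le_double i k : (0 < k)%N -> (1 <= i <= h)%N -> (s i k <= 2 * s 1 k)%N.
Proof.
move=> k_gt0 hi; have : (r i <= r h)%N.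
  have [->//|ih] := eqVneq i h; apply: ltnW; apply: r_incr; lia.
by rewrite /sprog; nia.
Qed.

Lemma expn_sprog_le_Sprod k : (s 1 k ^ h <= S k)%N.
Proof.
have -> : (s 1 k ^ h = \prod_(1 <= i < h.+1) s 1 k)%N.
  by rewrite prod_nat_const_nat subn1.
by apply: leq_prod_nat => i hi _; apply: sprog_le; lia.
Qed.

Lemma Sprod_le_expn_sprog k : (0 < k)%N -> (S k <= (2 * s 1 k) ^ h)%N.
Proof.
move=> k_gt0; have -> : ((2 * s 1 k) ^ h = \prod_(1 <= i < h.+1) (2 * s 1 k))%N.
  by rewrite prod_nat_const_nat subn1.
by apply: leq_prod_nat => i hi _; apply: sprog_le_double; lia.
Qed.

Lemma expn_sprog_le_aprod i k : (1 <= i <= h)%N -> (s 1 k ^ h <= s 1 k * a i k)%N.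
Proof.
move=> hi; have -> : (s 1 k ^ h = \prod_(1 <= j < h.+1) s 1 k)%N.
  by rewrite prod_nat_const_nat subn1.
rewrite (bigD1_seq i) ?iota_uniq ?mem_index_iota //=.
rewrite leq_mul2l; apply/orP; right.
by apply: leq_prod_nat => j hj _; apply: sprog_le; lia.
Qed.

Lemma sprog_le_aprod i k : (1 <= i <= h)%N -> (s 1 k <= a i k)%N.
Proof.
move=> hi; have s1_gt0 : (0 < s 1 k)%N by apply: sprog_gt0; lia.
rewrite -(leq_pmul2l s1_gt0); apply: leq_trans (expn_sprog_le_aprod k hi).
by rewrite -[leqLHS]/(s 1 k ^ 2)%N leq_pexp2l.
Qed.

(** The factor 2 lost in [expn_lt_double_level] is absorbed by [2 <= 2 ^ h]. *)
Lemma expn_le_level t : (0 < t)%N -> (M ^ t <= (4 * s 1 (K t)) ^ h)%N.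
Proof.
move=> t_gt0; apply: leq_trans (ltnW (expn_lt_double_level t_gt0)) _.
have kt_gt0 : (0 < K t)%N by apply: leq_trans (level_ge t_gt0).
rewrite (_ : 4 * s 1 (K t) = 2 * (2 * s 1 (K t)))%N; last by lia.
rewrite expnMn; apply: leq_mul; last exact: Sprod_le_expn_sprog.
by rewrite -[leqLHS]expn1 leq_pexp2l //; lia.
Qed.

(* Number of [v] such that [a i (K t) * v] is in [Vset h P r k1 t] and at most [X]. *)
Let nmul X t i := minn ((h - 1) * S (K t.+1) %/ a i (K t)) (X %/ a i (K t)).

(** The constant [4 * (h - 1) * M] combines the factor [2 * M] between levels with [s i <= 2 * s 1];
    [4 ^ h] comes from [expn_le_level]. *)
Lemma nmul_le_tent (R : realFieldType) (q y : R) X t i :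
  (0 < t)%N -> (1 <= i <= h)%N -> 0 < q -> 0 < y ->
  q ^+ h = M%:R -> X%:R <= y ^+ h ->
  (nmul X t i)%:R <= (4 * (h - 1) * M + 4 ^ h)%:R * tent q y t.
Proof.
move=> t_gt0 hi q0 y0 qM Xy.
have kt_gt0 : (0 < K t)%N by apply: leq_trans (level_ge t_gt0).
have a_gt0 := aprod_gt0 (K t) hi.
apply: (@natr_le_tent _ h t _ (s 1 (K t)) (a i (K t)) _ M q (y ^+ h) y) => //.
- have /andP[+ _] := level_spec t_gt0.
  exact/leq_trans/expn_sprog_le_Sprod.
- exact: expn_le_level.
- exact: expn_sprog_le_aprod.
- apply: leq_trans (geq_minl _ _) _; rewrite -(leq_pmul2r a_gt0).
  apply: leq_trans (leq_trunc_div _ _) _.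
  apply: leq_trans (leq_mul (leqnn _) (Sprod_levelS t_gt0)) _.
  rewrite (Sprod_mulD1 (K t) hi).
  have := leq_mul (leqnn (2 * (h - 1) * M * a i (K t))) (sprog_le_double kt_gt0 hi).
  lia.
- apply: le_trans Xy; rewrite ler_nat.
  apply: (@leq_trans (X %/ a i (K t) * a i (K t))%N); last exact: leq_trunc_div.
  by rewrite leq_mul2r geq_minr orbT.
Qed.

Lemma counting_thin_set_le (R : realType) (q x y : R) :
  1 < q -> q ^+ h = M%:R -> 1 <= y -> y ^+ h = x ->
  (counting_fun (thin_set h P r k1) x)%:R <=
    (((h - 1) * M)%:R + h%:R * (4 * (h - 1) * M + 4 ^ h)%:R * (q / (q - 1) * 2)) * y.
Proof.
move=> q1 qM y1 yx.
have y0 : 0 < y by lra.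
have q0 : 0 < q by lra.
have x0 : 0 <= x by rewrite -yx exprn_ge0 // ltW.
pose X := Num.truncn x.
have Xx : X%:R <= x by rewrite truncn_le.
(* An element of [V(t)] up to [X] forces [s 1 (K t) <= X], hence [t < M ^ t <= (4 * X) ^ h]. The
   size of this cutoff is harmless, since [sum_tent_le] is uniform in [N]. *)
pose N := ((4 * X) ^ h).+1.
pose mult t i := [seq (a i (K t) * v)%N | v <- iota 1 (nmul X t i)].
pose blocks := flatten [seq flatten [seq mult t i | i <- index_iota 1 h.+1]
  | t <- index_iota 1 N].
have mem_all n : thin_set h P r k1 n -> (1 <= n)%N -> n%:R <= x ->
    n \in iota 1 ((h - 1) * M) ++ blocks.
  move=> An n_gt0; rewrite -truncn_ge_nat // -/X => nX; rewrite mem_cat.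
  case: An => [/= n_le|[t t_gt0] /VsetP[i [v [hi v_gt0 av nE]]]].
    by rewrite mem_iota; apply/orP; left; lia.
  have a_gt0 := aprod_gt0 (K t) hi.
  apply/orP; right; apply/flatten_mapP; exists t.
    rewrite mem_index_iota t_gt0 ltnS /N.
    have sX : (s 1 (K t) <= X)%N.
      apply: leq_trans nX; rewrite nE; apply: leq_trans (sprog_le_aprod _ hi) _.
      by rewrite leq_pmulr.
    apply: leq_trans (ltnW (ltn_expl t Sbase_ge2)) _.
    apply: leq_trans (expn_le_level t_gt0) _.
    by rewrite leq_exp2r ?leq_mul2l // ltnW.
  apply/flatten_mapP; exists i; first by rewrite mem_index_iota; lia.
  apply/mapP; exists v => //; rewrite mem_iota v_gt0 add1n ltnS.
  by rewrite leq_min !leq_divRL // mulnC av -nE nX.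
have := counting_fun_le_size mem_all.
rewrite size_cat size_iota size_flatten_map => cnt.
apply: (@le_trans _ _ (((h - 1) * M)%:R + \sum_(1 <= t < N)
    h%:R * (4 * (h - 1) * M + 4 ^ h)%:R * tent q y t)).
  move: cnt; rewrite -(ler_nat R) natrD => /le_trans; apply.
  rewrite lerD2l natr_sum; apply: ler_sum_nat => t /andP[t_gt0 _].
  rewrite size_flatten_map natr_sum.
  apply: (@le_trans _ _ (\sum_(1 <= i < h.+1) (4 * (h - 1) * M + 4 ^ h)%:R * tent q y t)).
    apply: ler_sum_nat => i hi; rewrite size_map size_iota.
    by apply: nmul_le_tent => //; rewrite yx.
  by rewrite sumr_const_nat (subSS 0 h) subn0 -mulrA [leRHS]mulr_natl.
rewrite -mulr_sumr mulrDl; apply: lerD.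
  by rewrite ler_peMr // ler0n.
rewrite -!mulrA !(ler_wpM2l, ler0n) // mulrA mulrA.
apply: le_trans (sum_tent_le N q1 y0).
(* Levels start at 1, whereas [sum_tent_le] starts at 0; the extra term is nonnegative. *)
rewrite -(big_mkord xpredT (tent q y)) [leRHS]big_ltn //.
by rewrite lerDr tent_ge0 // ltW.
Qed.

Lemma thin_set_limf_esup (R : realType) :
  (limf_esup (fun x : R =>
     ((counting_fun (thin_set h P r k1) x)%:R / x `^ (h%:R^-1))%:E)
     (pinfty_nbhs R) < +oo)%E.
Proof.
pose q := (M%:R : R) `^ (h%:R^-1).
have h0 : (0 : R) < h%:R by rewrite ltr0n; lia.
have powK (x : R) : 0 <= x -> (x `^ (h%:R^-1)) ^+ h = x.
  move=> x0; rewrite -powR_mulrn ?powR_ge0 // -powRrM mulVf ?gt_eqF //.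
  by rewrite powRr1.
have q1 : 1 < q.
  have -> : 1 = (1 : R) `^ (h%:R^-1) by rewrite powR1.
  apply: gt0_ltr_powR; rewrite ?nnegrE ?invr_gt0 ?ler0n // ltr1n.
  exact: Sbase_ge2.
have qM : q ^+ h = M%:R by apply: powK; rewrite ler0n.
pose C := ((h - 1) * M)%:R + h%:R * (4 * (h - 1) * M + 4 ^ h)%:R * (q / (q - 1) * 2).
apply: (@le_lt_trans _ _ C%:E); last exact: ltry.
(* The limsup is an infimum of suprema over neighbourhoods of infinity; the one given by [1 <= x]
   already yields the bound [C]. *)
apply: ge_ereal_inf; exists (ereal_sup [set
  ((counting_fun (thin_set h P r k1) x)%:R / x `^ (h%:R^-1))%:E
    | x in [set x : R | 1 <= x]])%classic.
  by exists [set x : R | 1 <= x]%classic => //; exact: nbhs_pinfty_ge.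
apply: ge_ereal_sup => _ [x /= x1 <-]; rewrite lee_fin.
have y1 : 1 <= x `^ (h%:R^-1).
  apply: (@le_trans _ _ (1 `^ (h%:R^-1))); first by rewrite powR1.
  by apply: ge0_ler_powR; rewrite ?nnegrE ?invr_ge0 ?ler0n //; lra.
rewrite ler_pdivrMr; last by lra.
by apply: counting_thin_set_le => //; apply: powK; lra.
Qed.

End Levels.

End Progressions.

Theorem theorem1 (R : realType) (h k1 P : nat) (r : nat -> nat)
  (hh : (2 <= h)%N)
  (hk1 : (k0 R h <= k1%:Z)%R)
  (hrpos : forall i, (1 <= i <= h)%N -> (0 < r i)%N)
  (hrinc : forall i j, (1 <= i)%N -> (i < j)%N -> (j <= h)%N -> (r i < r j)%N)
  (hrcop : forall i j, (1 <= i)%N -> (i < j)%N -> (j <= h)%N ->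
             coprime (r i) (r j))
  (hPpos : (0 < P)%N)
  (hPge : (r h - r 1 <= P)%N)
  (hPdvd : forall i j p, (1 <= i)%N -> (i < j)%N -> (j <= h)%N ->
             prime p -> (p %| r j - r i)%N -> (p %| P)%N) :
  is_thin_basis R h (thin_set h P r k1).
Proof.
have h_gt0 : (0 < h)%N by lia.
have hk k : (k1 <= k)%N -> (0 < k)%N && (k.+1 ^ h <= 2 * k ^ h)%N.
  by move=> k1k; apply: expnS_le_double h_gt0 (le_trans hk1 _); lia.
have k1_gt0 : (0 < k1)%N by case/andP: (hk k1 (leqnn _)).
have hk2 k : (k1 <= k)%N -> (k.+1 ^ h <= 2 * k ^ h)%N by case/hk/andP.
split; last by apply: thin_set_limf_esup => //; lia.
apply: thin_set_basis => // i j k i1 ij jh.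
rewrite /coprime -[_ == _]negbK; apply/negP => g_neq1.
have g_gt1 : (1 < gcdn (sprog P r i k) (sprog P r j k))%N.
  by rewrite ltn_neqAle eq_sym g_neq1 gcdn_gt0 (@sprog_gt0 h) //; lia.
have [p p_prime] := pdivP g_gt1; rewrite dvdn_gcd => /andP[pi pj].
have pP : (p %| P)%N.
  (* The common term [k * P] cancels in the difference, leaving [r j - r i]. *)
  apply: (hPdvd i j) => //; have := dvdn_sub pj pi.
  by rewrite /sprog subnDl.
have pr u : (p %| sprog P r u k)%N -> (p %| r u)%N.
  by rewrite /sprog dvdn_addr // dvdn_mull.
have := dvdn_gcd p (r i) (r j); rewrite (eqP (hrcop _ _ i1 ij jh)) !pr //.
by rewrite dvdn1 => /eqP p1; rewrite p1 in p_prime.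
Qed.
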